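(* The following decision problem is undecidable. Instance: a (finite) term rewriting system $\mathcal R$ over a signature $\Sigma$. Question: does equality saturation terminate with $\mathcal R$ and $G$ for all (finite) E-graphs $G$ over $\Sigma$?
   Context: A signature $\Sigma$ is a finite set of function symbols with arities; $T(\Sigma)$ is the set of ground terms. A term rewriting system $\mathcal R$ is a set of rules $\mathit{lhs}\to\mathit{rhs}$ between terms with variables, with $\mathrm{Var}(\mathit{rhs})\subseteq\mathrm{Var}(\mathit{lhs})$. A (bottom-up) tree automaton $\mathcal A=\langle Q,\Sigma,\Delta\rangle$ (no final states) has a set $Q$ of states and a set $\Delta$ of transitions $f(q_1,\dots,q_n)\to q$. Viewing states as nullary symbols, $\to^*_{\mathcal A}$ is the reflexive-transitive closure of rewriting by $\Delta$ on $T(\Sigma\cup Q)$. $\mathcal A$ is deterministic if $s\to^*_{\mathcal A}q_1$ and $s\to^*_{\mathcal A}q_2$ ($s\in T(\Sigma)$, $q_i\in Q$) imply $q_1=q_2$, and reachable if every state $q$ satisfies $s\to^*_{\mathcal A}q$ for some $s\in T(\Sigma)$. An E-graph is a deterministic and reachable tree automaton. A homomorphism is a map of states that sends transitions to transitions; $\mathcal A\sqsubseteq\mathcal B$ means a homomorphism $\mathcal A\to\mathcal B$ exists; this is a partial order on E-graphs up to isomorphism. $\mathrm{CC}(\mathcal A)$, for a reachable tree automaton $\mathcal A$, is the $\sqsubseteq$-least E-graph above $\mathcal A$. For an E-graph $G$ with states $Q$, $T_{\mathcal R}(G)$ is the tree automaton obtained from $G$ by adding, for every rule $\mathit{lhs}\to\mathit{rhs}$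 in $\mathcal R$, every $\sigma:\mathrm{Var}(\mathit{lhs})\to Q$ and $c\in Q$ with $\mathit{lhs}[\sigma]\to^*_G c$, the flattening of $s=\mathit{rhs}[\sigma]$ with root $c$: put $q_s=c$, $q_u=u$ for subterms $u\in Q$, a fresh state $q_u$ for every other proper subterm $u$ of $s$, and add the transition $f(q_{u_1},\dots,q_{u_k})\to q_u$ for every subterm $u=f(u_1,\dots,u_k)$ of $s$ with $f\in\Sigma$; if $s$ is itself a state, it is identified with $c$. Let $\mathrm{ICO}_{\mathcal R}=\mathrm{CC}\circ T_{\mathcal R}$. Equality saturation terminates with $\mathcal R$ and $G$ if $\mathrm{ICO}^{(n)}_{\mathcal R}(G)$ is a fixpoint of $\mathrm{ICO}_{\mathcal R}$ (up to isomorphism) for some finite $n$. *)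

(* Defs.v *)
From Stdlib Require List Relation_Operators.
From mathcomp Require Export all_boot.

Set Implicit Arguments.
Unset Strict Implicit.
Unset Printing Implicit Defensive.

(* The symbols of a signature are the numbers below its size; the n-th entry
   is the arity of the n-th symbol. *)
Definition signature := seq nat.

Definition has_arity (S : signature) (f n : nat) : bool :=
  (f < size S) && (nth 0 S f == n).

(* The leaves [Var v] are the variables of a rule when [V] is [nat], and the
   states, seen as nullary symbols, when [V] is the state set of an automaton;
   [term void] is the type of ground terms. *)
Inductive term (V : Type) : Type :=
| Var of V
| App of nat & seq (term V).

Fixpoint term_wf (S : signature) (V : Type) (t : term V) : bool :=
  match t with
  | Var _ => true
  | App f ts => has_arity S f (size ts) && all (term_wf S (V := V)) ts
  end.

Fixpoint vars (V : Type) (t : term V) : seq V :=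
  match t with
  | Var v => [:: v]
  | App _ ts => flatten (map (vars (V := V)) ts)
  end.

(* [tmap s t] is the instance t[s]. *)
Fixpoint tmap (V W : Type) (s : V -> W) (t : term V) : term W :=
  match t with
  | Var v => Var (s v)
  | App f ts => App f (map (tmap s) ts)
  end.

Inductive subterm (V : Type) (u : term V) : term V -> Prop :=
| subterm_refl : subterm u u
| subterm_arg f ts t : List.In t ts -> subterm u t -> subterm u (App f ts).

Definition proper_subterm (V : Type) (u t : term V) : Prop :=
  match t with
  | Var _ => False
  | App _ ts => exists2 t', List.In t' ts & subterm u t'
  end.

Definition rule := (term nat * term nat)%type.

Definition rule_wf (S : signature) (r : rule) : bool :=
  [&& term_wf S r.1, term_wf S r.2 & all (fun x => x \in vars r.1) (vars r.2)].

Record trs : Type := Trs {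
  trs_sig : signature;
  trs_rules : seq rule;
  trs_wf : all (rule_wf trs_sig) trs_rules
}.

Record automaton (S : signature) : Type := Automaton {
  state : Type;
  delta : nat -> seq state -> state -> Prop;
  delta_wf : forall f qs q, delta f qs q -> has_arity S f (size qs)
}.

Inductive step (S : signature) (A : automaton S) :
    term (state A) -> term (state A) -> Prop :=
| step_root f qs q : delta f qs q ->
    step (App f (map (@Var (state A)) qs)) (Var q)
| step_arg f l s t r : step s t ->
    step (App f (l ++ s :: r)) (App f (l ++ t :: r)).

Definition steps (S : signature) (A : automaton S) :
    term (state A) -> term (state A) -> Prop :=
  Relation_Operators.clos_refl_trans _ (@step S A).

Definition evaluates (S : signature) (A : automaton S)
    (s : term void) (q : state A) : Prop :=
  steps (tmap (@of_void (state A)) s) (Var q).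

Definition deterministic (S : signature) (A : automaton S) : Prop :=
  forall (s : term void) (q1 q2 : state A),
    term_wf S s -> evaluates s q1 -> evaluates s q2 -> q1 = q2.

Definition reachable (S : signature) (A : automaton S) : Prop :=
  forall q : state A, exists2 s : term void, term_wf S s & evaluates s q.

Definition egraph (S : signature) (A : automaton S) : Prop :=
  deterministic A /\ reachable A.

(* The signature being finite, there are then finitely many transitions. *)
Definition finite_automaton (S : signature) (A : automaton S) : Prop :=
  exists l : seq (state A), forall q, List.In q l.

Definition hom (S : signature) (A B : automaton S) (h : state A -> state B) :
    Prop :=
  forall f qs q, delta f qs q -> delta f (map h qs) (h q).

Definition hom_le (S : signature) (A B : automaton S) : Prop :=
  exists h : state A -> state B, hom h.

Definition isomorphic (S : signature) (A B : automaton S) : Prop :=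
  exists (h : state A -> state B) (g : state B -> state A),
    [/\ hom h, hom g, cancel h g & cancel g h].

(* Least E-graphs above [A] are determined up to isomorphism only, hence a
   relation. *)
Definition is_CC (S : signature) (A B : automaton S) : Prop :=
  [/\ egraph B, hom_le A B &
      forall C : automaton S, egraph C -> hom_le A C -> hom_le B C].

Section TR.
Variables (R : trs) (G : automaton (trs_sig R)).

Let Q := state G.

(* The substitution only matters on the variables of the left-hand side. It is
   a total function here: this loses nothing, as [c] witnesses that [Q] is
   inhabited. *)
Definition fires (r : rule) (s : nat -> Q) (c : Q) : Prop :=
  List.In r (trs_rules R) /\ steps (tmap s r.1) (Var c).

Definition restr (r : rule) (s : nat -> Q) : seq Q := map s (vars r.1).

(* The fresh states: one for each rule, restriction of a substitution to the
   variables of the left-hand side (given by its list of values), root, and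
   proper subterm, not a state, of the instance of the right-hand side. *)
Record fresh : Type := Fresh {
  fr_rule : rule;
  fr_subst : seq Q;
  fr_root : Q;
  fr_term : term Q;
  fr_ok : exists s : nat -> Q,
    [/\ fires fr_rule s fr_root,
        fr_subst = restr fr_rule s,
        proper_subterm fr_term (tmap s fr_rule.2) &
        forall q, fr_term <> Var q]
}.

Definition prestate := (Q + fresh)%type.

(* [node r vs c u x]: [x] is the state q_u, for a proper subterm u, in the
   flattening associated with [r], [vs] and [c]. *)
Inductive node (r : rule) (vs : seq Q) (c : Q) : term Q -> prestate -> Prop :=
| node_state q : node r vs c (Var q) (inl q)
| node_fresh x : fr_rule x = r -> fr_subst x = vs -> fr_root x = c ->
    node r vs c (fr_term x) (inr x).

Inductive predelta : nat -> seq prestate -> prestate -> Prop :=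
| predelta_old f (qs : seq Q) (q : Q) : delta f qs q ->
    predelta f (map inl qs) (inl q)
| predelta_root r s c f us xs : fires r s c ->
    tmap s r.2 = App f us ->
    List.Forall2 (node r (restr r s) c) us xs ->
    predelta f xs (inl c)
| predelta_inner r s c f us xs x : fires r s c ->
    proper_subterm (App f us) (tmap s r.2) ->
    List.Forall2 (node r (restr r s) c) us xs ->
    node r (restr r s) c (App f us) x ->
    predelta f xs x.

(* The identification of [s] with the root when the instance of the right-hand
   side is itself a state. *)
Inductive ident : prestate -> prestate -> Prop :=
| ident_root r s c q : fires r s c -> tmap s r.2 = Var q ->
    ident (inl q) (inl c).

Definition same : prestate -> prestate -> Prop :=
  Relation_Operators.clos_refl_sym_trans _ ident.

Definition TR_state : Type :=
  {P : prestate -> Prop | exists x, P = same x}.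

Definition TR_class (x : prestate) : TR_state :=
  exist _ (same x) (ex_intro _ x erefl).

Definition TR_delta (f : nat) (ps : seq TR_state) (p : TR_state) : Prop :=
  exists xs x, [/\ predelta f xs x, ps = map TR_class xs & p = TR_class x].

Lemma term_wf_tmap S V W (s : V -> W) (t : term V) :
  term_wf S t -> term_wf S (tmap s t).
Proof.
move: t; fix IH 1 => -[//|f ts] /= /andP[arf wfts]; rewrite size_map arf /=.
by elim: ts {arf} wfts => //= t ts IHts /andP[wft /IHts->]; rewrite IH.
Qed.

Lemma term_wf_arg S V (ts : seq (term V)) t :
  List.In t ts -> all (term_wf S (V := V)) ts -> term_wf S t.
Proof.
by elim: ts => //= u ts IHts [-> /andP[]|/IHts{}IHts /andP[_ /IHts]].
Qed.

Lemma term_wf_subterm S V (u t : term V) :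
  subterm u t -> term_wf S t -> term_wf S u.
Proof.
elim=> //= f ts t' in_ts _ IH /andP[_ wfts].
by apply: IH; apply: term_wf_arg in_ts wfts.
Qed.

Lemma proper_subterm_subterm V (u t : term V) :
  proper_subterm u t -> subterm u t.
Proof. by case: t => //= f ts [t' in_ts /subterm_arg]; apply. Qed.

Lemma fires_rhs_wf r s c : fires r s c -> term_wf (trs_sig R) (tmap s r.2).
Proof.
case=> in_R _; apply: term_wf_tmap; move: (trs_wf R).
elim: (trs_rules R) in_R => //= r' rs IH [-> /andP[/and3P[_ ->]]//|/IH{}IH].
by case/andP=> _ /IH.
Qed.

Lemma Forall2_size T U (P : T -> U -> Prop) us xs :
  List.Forall2 P us xs -> size us = size xs.
Proof. by elim=> //= *; congr _.+1. Qed.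

Lemma TR_delta_wf f ps p : TR_delta f ps p -> has_arity (trs_sig R) f (size ps).
Proof.
case=> xs [x [dx -> _]]; rewrite size_map.
case: f xs x / dx => [f qs q /delta_wf|r s c f us xs fi|r s c f us xs x fi].
- by rewrite size_map.
- move=> e /Forall2_size<-; move: (fires_rhs_wf fi).
  by rewrite e => /= /andP[].
- move=> /proper_subterm_subterm/term_wf_subterm/(_ (fires_rhs_wf fi)) wf.
  by move=> /Forall2_size<- _; case/andP: wf.
Qed.

Definition TR : automaton (trs_sig R) := Automaton TR_delta_wf.

End TR.

Definition is_ICO (R : trs) (G H : automaton (trs_sig R)) : Prop :=
  is_CC (TR G) H.

Inductive is_ICO_iter (R : trs) (G : automaton (trs_sig R)) :
    nat -> automaton (trs_sig R) -> Prop :=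
| is_ICO_iter0 : is_ICO_iter G 0 G
| is_ICO_iterS n H K :
    is_ICO_iter G n H -> is_ICO H K -> is_ICO_iter G n.+1 K.

Definition eqsat_terminates (R : trs) (G : automaton (trs_sig R)) : Prop :=
  exists n H, is_ICO_iter G n H /\ exists2 H', is_ICO H H' & isomorphic H' H.

(* The model of computation is the Turing-complete language WHILE of N. D.
   Jones (Computability and Complexity from a Programming Perspective, MIT
   Press, 1997): imperative programs whose values are binary trees. *)

Inductive tree : Type := Nil | Cons of tree & tree.

Inductive expr : Type :=
| EVar of nat
| ENil
| ECons of expr & expr
| EHd of expr
| ETl of expr.

Inductive com : Type :=
| Assign of nat & expr
| Seq of com & com
| While of expr & com.

Definition store := nat -> tree.

Definition hd (d : tree) : tree := if d is Cons a _ then a else Nil.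
Definition tl (d : tree) : tree := if d is Cons _ b then b else Nil.

Fixpoint eval (m : store) (e : expr) : tree :=
  match e with
  | EVar x => m x
  | ENil => Nil
  | ECons e1 e2 => Cons (eval m e1) (eval m e2)
  | EHd e1 => hd (eval m e1)
  | ETl e1 => tl (eval m e1)
  end.

Definition update (m : store) (x : nat) (d : tree) : store :=
  fun y => if y == x then d else m y.

Inductive exec : com -> store -> store -> Prop :=
| exec_assign x e m : exec (Assign x e) m (update m x (eval m e))
| exec_seq c1 c2 m m' m'' :
    exec c1 m m' -> exec c2 m' m'' -> exec (Seq c1 c2) m m''
| exec_while_stop e c m : eval m e = Nil -> exec (While e c) m m
| exec_while_loop e c m m' m'' : eval m e <> Nil ->
    exec c m m' -> exec (While e c) m' m'' -> exec (While e c) m m''.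

(* Input and output are in variable 0; all other variables are initially
   [Nil]. *)
Definition computes (c : com) (d d' : tree) : Prop :=
  exists m, exec c (update (fun _ => Nil) 0 d) m /\ m 0 = d'.

Definition ttrue : tree := Cons Nil Nil.
Definition tfalse : tree := Nil.

Definition is_decidable (I : Type) (enc : I -> tree) (P : I -> Prop) : Prop :=
  exists c : com, forall i : I,
    (P i -> computes c (enc i) ttrue) /\ (~ P i -> computes c (enc i) tfalse).

Definition enc_nat (n : nat) : tree := iter n (Cons Nil) Nil.

Definition enc_seq (T : Type) (enc : T -> tree) (s : seq T) : tree :=
  foldr (fun x d => Cons (enc x) d) Nil s.

Fixpoint enc_term (t : term nat) : tree :=
  match t with
  | Var x => Cons Nil (enc_nat x)
  | App f ts => Cons ttrue (Cons (enc_nat f) (enc_seq enc_term ts))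
  end.

Definition enc_rule (r : rule) : tree := Cons (enc_term r.1) (enc_term r.2).

Definition enc_trs (R : trs) : tree :=
  Cons (enc_seq enc_nat (trs_sig R)) (enc_seq enc_rule (trs_rules R)).

(* Main.v *)
(* A term rewriting system can interpret WHILE programs: the fixed rules
   [interp_rules] evaluate the control stack and the store of a program coded as
   a tree, and one extra rule starts the program coded by [d] on input [d].  Two
   rules turn halting into collapse: every class becomes equal to [join x init],
   where [init] is in the class of all the configurations of the run, and
   [join x c] is equal to a constant when [c] is halted.  Hence if the run halts,
   every term rewrites to that constant, and saturation stops from any E-graph.
   If the run diverges, saturation from the single state [init] never stops: the
   configurations carry a step counter, and the [n]-th iterate maps to a model
   containing only the configurations of the first [n] steps.

   Given a decision procedure, the program that computes the system of its
   input, calls the procedure on it and loops on the answer "true" yields a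
   contradiction when run on its own code. *)
Require Import Defs.
From Stdlib Require Import ClassicalEpsilon FunctionalExtensionality PropExtensionality.

Set Implicit Arguments.
Unset Strict Implicit.
Unset Printing Implicit Defensive.

(** * Evaluation of terms in automata *)

(** The list recursion keeps [P] as a fixed parameter, so that the guard condition accepts
    [all2P (holds rho) ts qs] in the recursion on terms that defines [holds]. *)
Definition all2P T U (P : T -> U -> Prop) :=
  fix loop (ts : seq T) (us : seq U) : Prop :=
    match ts, us with
    | [::], [::] => True
    | t :: ts', u :: us' => P t u /\ loop ts' us'
    | _, _ => False
    end.

Lemma all2P_nil T U (P : T -> U -> Prop) : all2P P [::] [::].
Proof. by []. Qed.

Lemma all2P_cons T U (P : T -> U -> Prop) t ts u us :
  P t u -> all2P P ts us -> all2P P (t :: ts) (u :: us).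
Proof. by []. Qed.

Lemma all2P_Forall2 T U (P : T -> U -> Prop) ts us :
  all2P P ts us <-> List.Forall2 P ts us.
Proof.
split; last by elim=> //=.
elim: ts us => [|t ts IH] [|u us] //= [Ptu /IH]; exact: List.Forall2_cons.
Qed.

Lemma all2P_impl T U (P Q : T -> U -> Prop) ts us :
  (forall t u, List.In t ts -> P t u -> Q t u) ->
  all2P P ts us -> all2P Q ts us.
Proof.
elim: ts us => [|t ts IH] [|u us] //= PQ [Ptu Pts].
by split; [apply: PQ => //; left | apply: IH => // t' u' ?; apply: PQ; right].
Qed.

Lemma all2P_size T U (P : T -> U -> Prop) ts us :
  all2P P ts us -> size ts = size us.
Proof. by elim: ts us => [|t ts IH] [|u us] //= [_ /IH->]. Qed.

Lemma all2P_mapl T T' U (P : T' -> U -> Prop) (g : T -> T') ts us :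
  all2P P (map g ts) us <-> all2P (fun t => P (g t)) ts us.
Proof. by elim: ts us => [|t ts IH] [|u us] //=; rewrite IH. Qed.

Lemma all2P_mapr T U U' (P : T -> U' -> Prop) (g : U -> U') ts us :
  all2P P ts (map g us) <-> all2P (fun t u => P t (g u)) ts us.
Proof. by elim: ts us => [|t ts IH] [|u us] //=; rewrite IH. Qed.

Lemma all2P_exists T U (P : T -> U -> Prop) ts :
  (forall t, List.In t ts -> exists u, P t u) -> exists us, all2P P ts us.
Proof.
elim: ts => [|t ts IH] Pts; first by exists [::].
have [u Ptu] := Pts t (or_introl erefl).
have [|us Pus] := IH; first by move=> t' ?; apply: Pts; right.
by exists (u :: us).
Qed.

Lemma all2P_In T U (P : T -> U -> Prop) ts us t :
  all2P P ts us -> List.In t ts -> exists u, P t u.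
Proof.
elim: ts us => [|t' ts IH] [|u us] //= [Ptu /IH Pts] [<-|/Pts//].
by exists u.
Qed.

Lemma all2P_functional T U (P : T -> U -> Prop) ts us us' :
  (forall t u u', List.In t ts -> P t u -> P t u' -> u = u') ->
  all2P P ts us -> all2P P ts us' -> us = us'.
Proof.
elim: ts us us' => [|t ts IH] [|u us] [|u' us'] //= fP [Pu Pus] [Pu' Pus'].
congr cons; first by apply: fP Pu Pu'; left.
by apply: IH Pus Pus' => t' v v' ?; apply: fP; right.
Qed.

Lemma term_ind_In V (P : term V -> Prop) :
  (forall v, P (Var v)) ->
  (forall f ts, (forall t, List.In t ts -> P t) -> P (App f ts)) ->
  forall t, P t.
Proof.
move=> PV PA; fix IH 1 => -[v|f ts]; first exact: PV.
apply: PA; elim: ts => [|t ts IHts] t' /=; first by case.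
case=> [<-|]; [exact: IH | exact: IHts].
Qed.

Fixpoint subst V W (s : V -> term W) (t : term V) : term W :=
  match t with
  | Var v => s v
  | App f ts => App f (map (subst s) ts)
  end.

Lemma In_cat T (x : T) s1 s2 :
  List.In x (s1 ++ s2) <-> List.In x s1 \/ List.In x s2.
Proof. by elim: s1 => [|y s1 IH] /=; [tauto | rewrite IH; tauto]. Qed.

Lemma In_vars_App V f ts (t : term V) v :
  List.In t ts -> List.In v (vars t) -> List.In v (vars (App f ts)).
Proof.
by elim: ts => //= u ts IH [<-|/IH{}IH /IH]; rewrite In_cat; tauto.
Qed.

Section Evaluation.
Variables (S : signature) (A : automaton S).

(** Big-step evaluation with leaves valued by [rho]; [stepsP] identifies it with reduction of the
    instance to a state. *)
Fixpoint holds V (rho : V -> state A) (t : term V) (q : state A) : Prop :=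
  match t with
  | Var v => rho v = q
  | App f ts => exists2 qs, all2P (holds rho) ts qs & delta f qs q
  end.

Lemma holds_tmap V W (g : V -> W) (rho : W -> state A) t q :
  holds rho (tmap g t) q <-> holds (fun v => rho (g v)) t q.
Proof.
elim/term_ind_In: t q => //= f ts IH q.
by split=> -[qs ts_qs d]; exists qs => //; move: ts_qs; rewrite all2P_mapl;
  apply: all2P_impl => t p in_ts; apply IH.
Qed.

Lemma holds_wf V (rho : V -> state A) t q : holds rho t q -> term_wf S t.
Proof.
elim/term_ind_In: t q => //= f ts IH q [qs ts_qs /delta_wf].
rewrite -(all2P_size ts_qs) => -> /=.
elim: ts qs IH ts_qs => [|t ts IHts] [|p qs] //= IH [t_p ts_qs].
rewrite (IH t _ p) //; last by left.
by apply: IHts ts_qs => t' ? r; apply: IH; right.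
Qed.

Lemma holds_steps V (rho : V -> state A) t q :
  holds rho t q -> steps (tmap rho t) (Var q).
Proof.
elim/term_ind_In: t q => [v|f ts IH] q /=.
  by move=> ->; apply: Relation_Operators.rt_refl.
case=> qs ts_qs d; apply: Relation_Operators.rt_trans; last first.
  exact/Relation_Operators.rt_step/step_root/d.
(* Arguments are reduced from left to right; the empty prefix is generalised to a list [l] that
   collects those already reduced. *)
rewrite -[map (tmap _) _]cat0s -[map _ qs]cat0s; move: [::] => l {d}.
elim: ts qs l IH ts_qs => [|t ts IHts] [|p qs] l //= IH.
  by move=> _; apply: Relation_Operators.rt_refl.
case=> t_p ts_qs.
apply: (@Relation_Operators.rt_trans _ _ _ (App f (l ++ Var p :: map (tmap rho) ts))).
  have := IH t (or_introl erefl) p t_p.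
  elim=> [x y xy|x|x y z _ xy _ yz].
  - exact/Relation_Operators.rt_step/step_arg.
  - exact: Relation_Operators.rt_refl.
  - exact: Relation_Operators.rt_trans xy yz.
rewrite -!cat_rcons; apply: IHts => // t' ? r; apply: IH; by right.
Qed.

(** Values are preserved backwards along a step; as a state evaluates to itself, a reduction to a
    state becomes a big-step evaluation. *)
Lemma holds_step (t u : term (state A)) q :
  step t u -> holds id u q -> holds id t q.
Proof.
move=> tu; elim: tu q => {t u} [f qs q d _ /= <-|f l s t r _ IH q /= [qs ts_qs d]].
  by exists qs => //; apply/all2P_mapl; elim: qs {d} => //=.
exists qs => // {d}.
elim: l qs ts_qs => [|x l IHl] [|p qs] //= [x_p ts_qs]; split=> //; auto.
Qed.

Lemma stepsP V (rho : V -> state A) t q :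
  steps (tmap rho t) (Var q) <-> holds rho t q.
Proof.
split; last exact: holds_steps.
move=> ts; rewrite -(holds_tmap rho id).
suff: forall u, steps (tmap rho t) u -> holds id u q -> holds id (tmap rho t) q.
  by move=> /(_ _ ts); apply.
move=> u; elim=> [x y xy|//|x y z _ xy _ yz hz]; last exact/xy/yz.
exact: holds_step.
Qed.

Definition ev (t : term void) (q : state A) : Prop :=
  holds (@of_void (state A)) t q.

Lemma evP t q : evaluates t q <-> ev t q.
Proof. exact: stepsP. Qed.

Lemma holds_subterm V (rho : V -> state A) u t q :
  subterm u t -> holds rho t q -> exists p, holds rho u p.
Proof.
move=> ut; elim: ut q => {t} [q|f ts t in_ts _ IH q /= [qs ts_qs _]].
  by exists q.
by have [p /IH] := all2P_In ts_qs in_ts.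
Qed.

Lemma holds_subst V W (rho : W -> state A) (s : V -> state A)
    (sg : V -> term W) t q :
  (forall v, List.In v (vars t) -> holds rho (sg v) (s v)) ->
  holds s t q -> holds rho (subst sg t) q.
Proof.
elim/term_ind_In: t q => [v|f ts IH] q /= Hs; first by move=> <-; apply: Hs; left.
case=> qs ts_qs d; exists qs => //; apply/all2P_mapl.
apply: all2P_impl ts_qs => t p in_ts; apply: IH => // v in_t.
by apply: Hs; apply: In_vars_App in_ts in_t.
Qed.

Definition trans_det : Prop :=
  forall f qs q q', delta (a := A) f qs q -> delta f qs q' -> q = q'.

Hypothesis detA : trans_det.

Lemma holds_functional V (rho : V -> state A) t q q' :
  holds rho t q -> holds rho t q' -> q = q'.
Proof.
elim/term_ind_In: t q q' => [v|f ts IH] q q' /=; first by move=> <-.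
case=> qs ts_qs d [qs' ts_qs' d']; apply: detA d _.
suff -> : qs = qs' by [].
by apply: all2P_functional ts_qs ts_qs' => t p p' /IH; apply.
Qed.

(** The hypothesis makes [s v] the only possible value of [sg v], so a run on the instance factors
    through [s]. Where [sg v] has no value, [s] is arbitrary. *)
Lemma holds_unsubst V W (rho : W -> state A) (s : V -> state A)
    (sg : V -> term W) t q :
  (forall v p, holds rho (sg v) p -> s v = p) ->
  holds rho (subst sg t) q ->
  holds s t q /\ forall v, List.In v (vars t) -> holds rho (sg v) (s v).
Proof.
move=> Hs; elim/term_ind_In: t q => [v|f ts IH] q /=.
  move=> h; have e := Hs _ _ h; split=> // u [<-|//]; by rewrite e.
case=> qs /all2P_mapl ts_qs d; split.
  by exists qs => //; apply: all2P_impl ts_qs => t p /IH{}IH /IH[].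
elim: ts qs IH ts_qs {d} => //= t ts IHts [|p qs] //= IH [t_p ts_qs] v.
have [|_ ht] := IH t _ _ t_p; first by left.
case/In_cat=> [/ht//|].
by apply: IHts ts_qs _ => t' ? r; apply: IH; right.
Qed.

End Evaluation.

Lemma holds_hom S (A B : automaton S) (h : state A -> state B) V
    (rho : V -> state A) t q :
  hom h -> holds rho t q -> holds (fun v => h (rho v)) t (h q).
Proof.
move=> hh; elim/term_ind_In: t q => [v|f ts IH] q /=; first by move=> ->.
case=> qs ts_qs d; exists (map h qs); last exact: hh.
by apply/all2P_mapr; apply: all2P_impl ts_qs => t p /IH; apply.
Qed.

Lemma holds_ground S (A : automaton S) (rho rho' : void -> state A) t q :
  holds rho t q -> holds rho' t q.
Proof.
by have -> : rho = rho' by apply: functional_extensionality; case.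
Qed.

Lemma ev_hom S (A B : automaton S) (h : state A -> state B) t q :
  hom h -> ev t q -> ev t (h q).
Proof. by move=> hh /(holds_hom hh); apply: holds_ground. Qed.

Lemma ev_reachable S (A : automaton S) :
  reachable A <-> forall q : state A, exists t, ev t q.
Proof.
split=> rA q; have [t] := rA q; first by move=> _ /evP; exists t.
by move=> tq; exists t; [apply: holds_wf tq | apply/evP].
Qed.

(** For two transitions from the same states, reachability supplies ground terms for these states,
    and the two targets become values of one ground term. *)
Lemma egraphP S (A : automaton S) : egraph A <-> trans_det A /\ reachable A.
Proof.
split=> -[detA rA]; split=> //.
- move=> f qs q q' d d'; move/ev_reachable: rA => rA.
  have [|ts ts_qs] := @all2P_exists _ _ (fun q t => ev t q) qs.
    by move=> ? _; apply: rA.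
  have {}ts_qs : all2P (ev (A := A)) ts qs.
    by elim: qs ts ts_qs {d d'} => [|p qs IH] [|t ts] //= [? /IH].
  have ev1 : ev (App f ts) q by exists qs.
  have ev2 : ev (App f ts) q' by exists qs.
  by apply: (detA _ _ _ (holds_wf ev1)); apply/evP.
- by move=> s q q' _ /evP h /evP; apply: holds_functional h.
Qed.

Lemma id_hom S (A : automaton S) : @hom S A A id.
Proof. by move=> f qs q; rewrite map_id. Qed.

Lemma hom_le_trans S (A B C : automaton S) :
  hom_le A B -> hom_le B C -> hom_le A C.
Proof.
move=> [h hh] [g gg]; exists (g \o h) => f qs q d.
by rewrite map_comp; apply/gg/hh.
Qed.

(** * Congruence closure and saturation steps *)

Section Quotient.
Variables (T : Type) (E : T -> T -> Prop).

(** Classes are predicates, in the same form as [TR_state], so that the lemmas on quotients apply to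
    it by conversion. *)
Definition quot := {P : T -> Prop | exists x, P = E x}.
Definition cls (x : T) : quot := exist _ (E x) (ex_intro _ x erefl).

Definition rep (p : quot) : T :=
  proj1_sig (constructive_indefinite_description _ (proj2_sig p)).

Lemma quot_inj (p p' : quot) : sval p = sval p' -> p = p'.
Proof.
case: p p' => P exP [P' exP'] /= e; case: P' / e exP' => exP'.
by congr exist; apply: Classical_Prop.proof_irrelevance.
Qed.

Lemma repK : cancel rep cls.
Proof.
move=> p; apply: quot_inj; rewrite /rep /=.
by case: constructive_indefinite_description => x.
Qed.

Hypotheses (Er : forall x, E x x) (Es : forall x y, E x y -> E y x)
  (Et : forall x y z, E x y -> E y z -> E x z).

Lemma cls_eqP x y : cls x = cls y <-> E x y.
Proof.
split=> [e|xy]; first by have /= -> := congr1 sval e.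
apply: quot_inj; apply: functional_extensionality => z /=.
by apply: propositional_extensionality; split=> [/(Et (Es xy))|/(Et xy)].
Qed.

End Quotient.

Section CongruenceClosure.
Variables (S : signature) (A : automaton S).

Definition congruence (E : state A -> state A -> Prop) : Prop :=
  [/\ forall q, E q q, forall q r, E q r -> E r q,
      forall q r s, E q r -> E r s -> E q s &
      forall f qs qs' q q', delta f qs q -> delta f qs' q' ->
        all2P E qs qs' -> E q q'].

(** The intersection of all congruences, hence the least one. *)
Definition cong (q q' : state A) : Prop := forall E, congruence E -> E q q'.

Lemma cong_congruence : congruence cong.
Proof.
split=> [q E []//|q r qr E cE|q r s qr rs E cE|f qs qs' q q' d d' qq E cE].
- by case: (cE) => _ + _ _; apply; apply: qr.
- by case: (cE) => _ _ + _; apply; [apply: qr | apply: rs].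
- case: (cE) => _ _ _; apply; [exact: d | exact: d' |].
  by apply: all2P_impl qq => t u _; apply.
Qed.

Definition CC_state := quot cong.

Definition CC_delta f (ps : seq CC_state) (p : CC_state) : Prop :=
  exists qs q, [/\ delta f qs q, ps = map (cls cong) qs & p = cls cong q].

Lemma CC_delta_wf f ps p : CC_delta f ps p -> has_arity S f (size ps).
Proof. by case=> qs [q [/delta_wf + -> _]]; rewrite size_map. Qed.

Definition CC : automaton S := Automaton CC_delta_wf.

Lemma cls_congP q q' : cls cong q = cls cong q' <-> cong q q'.
Proof. by have [r s t _] := cong_congruence; apply: cls_eqP. Qed.

Lemma CC_hom : @hom S A CC (cls cong).
Proof. by move=> f qs q d; exists qs, q. Qed.

Lemma CC_trans_det : trans_det CC.
Proof.
move=> f ps p p' [qs [q [d -> ->]]] [qs' [q' [d' e ->]]].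
apply/cls_congP; have [_ _ _] := cong_congruence; apply; [exact: d | exact: d' |].
elim: qs qs' e {d d'} => [|x qs IH] [|y qs'] //= [e es]; split; last exact: IH.
by apply/cls_congP; apply: quot_inj.
Qed.

Lemma CC_egraph : reachable A -> egraph CC.
Proof.
move=> /ev_reachable rA; apply/egraphP; split; first exact: CC_trans_det.
apply/ev_reachable => p; have [t tq] := rA (rep p); exists t.
by rewrite -(repK p); apply: ev_hom tq; apply: CC_hom.
Qed.

(** The kernel of a homomorphism into a deterministic automaton is a congruence, so it contains
    [cong] and the map can be computed on representatives. *)
Lemma CC_least (C : automaton S) : egraph C -> hom_le A C -> hom_le CC C.
Proof.
move=> /egraphP[detC _] [h hh]; exists (fun p => h (rep p)).
have hrep q : h (rep (cls cong q)) = h q.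
  have /cls_congP/(_ (fun q q' => h q = h q')) := repK (cls cong q).
  apply; split=> [//|//|? ? ? -> ->//|f qs qs' r r' d d' qq].
  apply: detC (hh _ _ _ d) _.
  suff -> : map h qs = map h qs' by apply: hh.
  by elim: qs qs' qq {d d'} => [|x qs IH] [|y qs'] //= [-> /IH->].
move=> f _ _ [qs [q [d -> ->]]]; rewrite -map_comp hrep.
suff -> : map ((fun p => h (rep p)) \o cls cong) qs = map h qs by apply: hh.
exact: eq_map.
Qed.

Lemma CC_is_CC : reachable A -> is_CC A CC.
Proof.
move=> rA; split; [exact: CC_egraph | | exact: CC_least].
by exists (cls cong); apply: CC_hom.
Qed.

End CongruenceClosure.

(** * The flattening of fired rules and its universal property *)

Section Saturation.
Variables (R : trs) (G : automaton (trs_sig R)).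
Let Q := state G.

Lemma firesP r (s : nat -> Q) c :
  fires r s c <-> List.In r (trs_rules R) /\ holds s r.1 c.
Proof. by rewrite /fires stepsP. Qed.

Lemma TR_class_eqP x y : TR_class x = TR_class y <-> @same R G x y.
Proof.
apply: cls_eqP; [exact: Relation_Operators.rst_refl|
  exact: Relation_Operators.rst_sym | exact: Relation_Operators.rst_trans].
Qed.

Definition emb (q : Q) : state (TR G) := TR_class (inl q).

Lemma emb_hom : hom emb.
Proof.
move=> f qs q d; exists (map inl qs), (inl q).
by rewrite -map_comp; split=> //; apply: predelta_old.
Qed.

Lemma subterm_arg_App V f (ts : seq (term V)) t u :
  List.In t ts -> subterm (App f ts) u -> proper_subterm t u.
Proof.
move=> in_ts; elim/term_ind_In: u => [v|g us IH] sub.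
  by inversion sub.
inversion sub; subst; first by exists t => //; apply: subterm_refl.
by exists t0 => //; apply/proper_subterm_subterm/IH.
Qed.

Lemma nodes_exist r (s : nat -> Q) (c : Q) us (fi : fires r s c) :
  (forall t, List.In t us -> proper_subterm t (tmap s r.2)) ->
  exists xs, all2P (node r (restr r s) c) us xs.
Proof.
move=> sub; apply: all2P_exists => -[q|g vs] /sub pt.
  by eexists; apply: node_state.
have ok : exists s0 : nat -> Q, [/\ fires r s0 c, restr r s = restr r s0,
    proper_subterm (App g vs) (tmap s0 r.2) & forall q, App g vs <> Var q].
  by exists s; split.
exists (inr (Fresh ok)); exact: (@node_fresh _ _ r (restr r s) c (Fresh ok)).
Qed.

Lemma node_holds r s c (fi : fires r s c) u x :
  proper_subterm u (tmap s r.2) -> node r (restr r s) c u x ->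
  holds emb u (TR_class x).
Proof.
elim/term_ind_In: u x => [v|f us IH] x pu nx /=.
  inversion nx as [q e1 e2|y _ _ _ e1]; subst; first by [].
  by case: (fr_ok y) => s' [_ _ _ /(_ v)]; rewrite e1.
have sub t : List.In t us -> proper_subterm t (tmap s r.2).
  by move=> ?; apply: subterm_arg_App (proper_subterm_subterm pu).
have [xs us_xs] := nodes_exist fi sub.
exists (map (@TR_class R G) xs).
  apply/all2P_mapr; apply: all2P_impl us_xs => t y in_us.
  by apply: IH => //; apply: sub.
exists xs, x; split=> //; apply: predelta_inner fi pu _ nx.
exact/all2P_Forall2.
Qed.

Lemma TR_fires r s c :
  fires r s c -> holds (fun v => emb (s v)) r.2 (emb c).
Proof.
move=> fi; rewrite -(holds_tmap s emb).
case e: (tmap s r.2) => [q|f us] /=.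
  by apply/TR_class_eqP/Relation_Operators.rst_step/ident_root/e.
have sub t : List.In t us -> proper_subterm t (tmap s r.2).
  by rewrite e => in_us; exists t => //; apply: subterm_refl.
have [xs us_xs] := nodes_exist fi sub.
exists (map (@TR_class R G) xs).
  apply/all2P_mapr; apply: all2P_impl us_xs => t y in_us.
  by apply: node_holds => //; apply: sub.
exists xs, (inl c); split=> //; apply: predelta_root fi e _.
exact/all2P_Forall2.
Qed.

(** A fresh state is the value of its subterm, whose leaves are states of [G]; these are replaced by
    ground terms that reach them. *)
Lemma TR_reachable : reachable G -> reachable (TR G).
Proof.
move=> /ev_reachable rG; apply/ev_reachable => p.
rewrite -(repK p); case: (rep p) => [q|x].
  by have [t tq] := rG q; exists t; exact: (ev_hom emb_hom tq).
have [s [fi es pu _]] := fr_ok x.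
have hx : holds emb (fr_term x) (TR_class (inr x)).
  by have := node_holds fi pu; rewrite -es; apply; constructor.
pose sg q := proj1_sig (constructive_indefinite_description _ (rG q)).
exists (subst sg (fr_term x)); apply: holds_subst hx => q _.
rewrite /sg; case: constructive_indefinite_description => t /= tq.
exact: (ev_hom emb_hom tq).
Qed.

(** A fresh state goes to the value of its subterm in [M], which exists because the whole right-hand
    side has a value, and is unique by determinism. *)
Lemma TR_lift (M : automaton (trs_sig R)) (h : Q -> state M) :
  trans_det M -> hom h ->
  (forall r s c, fires r s c -> holds (fun v => h (s v)) r.2 (h c)) ->
  hom_le (TR G) M.
Proof.
move=> detM hh hR.
have hR' r s c : fires r s c -> holds h (tmap s r.2) (h c).
  by move=> /hR; rewrite holds_tmap.
have frP (x : fresh G) : exists p, holds h (fr_term x) p.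
  have [s [fi _ /proper_subterm_subterm pu _]] := fr_ok x.
  by have := holds_subterm pu (hR' _ _ _ fi).
pose phi (x : prestate G) := match x with
  | inl q => h q
  | inr x => proj1_sig (constructive_indefinite_description _ (frP x))
  end.
have nodeP r vs c u x : node r vs c u x -> holds h u (phi x).
  case=> // y _ _ _ /=; by case: constructive_indefinite_description.
have nodesP r vs c us xs : List.Forall2 (node r vs c) us xs ->
    all2P (holds h) us (map phi xs).
  move=> /all2P_Forall2 n; apply/all2P_mapr; apply: all2P_impl n => t y _.
  exact: nodeP.
have predP f xs x : predelta f xs x -> delta f (map phi xs) (phi x).
  case=> {f xs x} [f qs q d|r s c f us xs fi e n|r s c f us xs x fi pu n nx].
  - by rewrite -map_comp; apply: hh.
  - have := hR' _ _ _ fi; rewrite e /= => -[qs us_qs].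
    suff -> : map phi xs = qs by [].
    apply: all2P_functional (nodesP _ _ _ _ _ n) us_qs => t p p' _.
    exact: holds_functional.
  - have /= [qs us_qs] := nodeP _ _ _ _ _ nx.
    suff -> : map phi xs = qs by [].
    apply: all2P_functional (nodesP _ _ _ _ _ n) us_qs => t p p' _.
    exact: holds_functional.
have sameP x y : same x y -> phi x = phi y.
  elim=> [_ _ [r s c q fi e]|//|? ? _ -> //|? ? ? _ -> _ -> //] /=.
  by have := hR' _ _ _ fi; rewrite e.
have repP x : phi (rep (TR_class x)) = phi x.
  by apply: sameP; apply/TR_class_eqP; apply: (repK (TR_class x)).
exists (fun p => phi (rep p)) => f _ _ [xs [x [d -> ->]]].
rewrite repP -map_comp (eq_map (g := phi)); first exact: predP.
by move=> y /=; apply: repP.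
Qed.

(** One saturation step performs every rewrite at the root of a ground term: the values of the terms
    [sg v] form a substitution by states with which the rule fires. *)
Lemma ev_fires K (g : state (TR G) -> state K) r sg (c : Q) :
  trans_det G -> trans_det K -> hom g -> List.In r (trs_rules R) ->
  ev (subst sg r.1) c -> ev (subst sg r.2) (g (emb c)).
Proof.
move=> detG detK hg inR ec.
have [s sP] : exists s : nat -> Q, forall v p, ev (sg v) p -> s v = p.
  have ex v : exists q : Q, forall p, ev (sg v) p -> q = p.
    case: (classic (exists q : Q, ev (sg v) q)) => [[q eq]|no].
      by exists q => p; apply: holds_functional eq.
    (* Without a value for [sg v], the state [c] is a default. *)
    by exists c => p ep; case: no; exists p.
  exists (fun v => proj1_sig (constructive_indefinite_description _ (ex v))) => v.
  by case: constructive_indefinite_description.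
have [h1 h2] := holds_unsubst sP ec.
have /TR_fires/(holds_hom hg) : fires r s c by apply/firesP.
apply: holds_subst => v in_v; apply: (ev_hom hg); apply: (ev_hom emb_hom).
apply: h2.
have : rule_wf (trs_sig R) r.
  elim: (trs_rules R) inR (trs_wf R) => //= r' rs IH [->|in_rs] /andP[wf_r wf_rs] //.
  exact: IH.
case/and3P=> _ _ /allP/(_ v).
have InP (l : seq nat) : v \in l <-> List.In v l.
  elim: l => //= u l IH; rewrite inE; split=> [/orP[/eqP->|/IH]|[->|/IH->]]; auto.
    by rewrite eqxx.
  by rewrite orbT.
by move=> h; apply/InP/h/InP.
Qed.

End Saturation.

(** * Iterated saturation *)

Inductive rewrites (R : trs) : term void -> term void -> Prop :=
| rw_refl t : rewrites R t t
| rw_trans s t u : rewrites R s t -> rewrites R t u -> rewrites R s u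
| rw_rule r sg : List.In r (trs_rules R) ->
    rewrites R (subst sg r.1) (subst sg r.2)
| rw_arg f l s t r : rewrites R s t ->
    rewrites R (App f (l ++ s :: r)) (App f (l ++ t :: r)).

Lemma rewrites_args R f ss ts :
  all2P (rewrites R) ss ts -> rewrites R (App f ss) (App f ts).
Proof.
move=> ss_ts.
suff /(_ [::]) : forall l, rewrites R (App f (l ++ ss)) (App f (l ++ ts)) by [].
elim: ss ts ss_ts => [|s ss IH] [|t ts] //=; first by move=> _ l; apply: rw_refl.
case=> st ss_ts l; apply: (@rw_trans _ _ (App f (l ++ t :: ss))).
  exact: rw_arg.
by rewrite -!cat_rcons; apply: IH.
Qed.

Lemma ev_context S (A : automaton S) f l s t r (q : state A) :
  (forall p : state A, ev s p -> ev t p) ->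
  ev (App f (l ++ s :: r)) q -> ev (App f (l ++ t :: r)) q.
Proof.
move=> st [qs ts_qs d]; exists qs => // {d}.
elim: l qs ts_qs => [|x l IH] [|p qs] //= [x_p ts_qs]; split=> //.
  exact: st.
exact: IH.
Qed.

(** An endomorphism of a reachable deterministic automaton is the identity, since it preserves
    values of ground terms. Applied to [g] after [emb], this makes evaluation in [H] closed under
    rewriting. *)
Lemma fixpoint_rewrites R (H : automaton (trs_sig R))
    (g : state (TR H) -> state H) :
  egraph H -> hom g ->
  forall s t, rewrites R s t -> forall q : state H, ev s q -> ev t q.
Proof.
move=> /egraphP[detH rH] hg s t.
elim=> {s t} [//|s t u _ st _ tu q /st/tu//|r sg inR q sq|].
  have -> : q = g (emb q).
    have [t tq] := (ev_reachable H).1 rH q.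
    exact: (holds_functional detH tq (ev_hom hg (ev_hom (@emb_hom R H) tq))).
  exact: ev_fires.
by move=> f l s t r _ IH q; apply: ev_context.
Qed.

(** * Concrete iterates, and termination by collapse *)

Section Stages.
Variables (R : trs) (G : automaton (trs_sig R)).
Hypothesis eG : egraph G.

Fixpoint stage n : automaton (trs_sig R) :=
  if n is n'.+1 then CC (TR (stage n')) else G.

Lemma stage_egraph n : egraph (stage n).
Proof.
elim: n => //= n /egraphP[_ rn]; exact/CC_egraph/TR_reachable.
Qed.

Lemma stage_det n : trans_det (stage n).
Proof. by have /egraphP[] := stage_egraph n. Qed.

Lemma stage_is_ICO n : is_ICO (stage n) (stage n.+1).
Proof. by apply/CC_is_CC/TR_reachable; case: (stage_egraph n). Qed.

Lemma stage_iter n : is_ICO_iter G n (stage n).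
Proof.
elim: n => [|n IH]; first exact: is_ICO_iter0.
exact: is_ICO_iterS IH (stage_is_ICO n).
Qed.

Lemma stage_hom m n : m <= n -> exists h : state (stage m) -> state (stage n), hom h.
Proof.
elim: n => [|n IH]; first by rewrite leqn0 => /eqP->; exists id; apply: id_hom.
rewrite leq_eqVlt => /orP[/eqP->|/IH]; first by exists id; apply: id_hom.
move=> h; apply: hom_le_trans h _.
apply: (@hom_le_trans _ _ (TR (stage n))).
  by exists (@emb R (stage n)); apply: emb_hom.
by case: (stage_is_ICO n).
Qed.

(** Every rewrite of a term with a value is eventually carried out; the homomorphisms between stages
    keep the equalities already obtained. *)
Lemma stage_rewrites s t : rewrites R s t ->
  forall n (q : state (stage n)), ev s q ->
  exists2 m, n <= m & exists2 p : state (stage m), ev s p & ev t p.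
Proof.
elim=> {s t} [s|s t u _ st _ tu|r sg inR|f l s t r _ IH] n q sq.
- by exists n => //; exists q.
- have [m nm [p sp tp]] := st n q sq.
  have [m' mm' [p' tp' up']] := tu m p tp.
  exists m'; first exact: leq_trans mm'.
  have [h hh] := stage_hom mm'.
  have := ev_hom hh tp => /(holds_functional (@stage_det m') tp') e.
  by exists p' => //; rewrite e; apply: ev_hom sp.
- exists n.+1 => //; exists (cls (@cong _ _) (emb q)).
    by apply: (ev_hom (@CC_hom _ _)); apply: (ev_hom (@emb_hom _ _)).
  by apply: ev_fires => //; [apply: stage_det | apply: stage_det | apply: CC_hom].
- have [p sp] : exists p : state (stage n), ev s p.
    case: sq => qs ts_qs _; apply: all2P_In ts_qs _.
    by elim: l => [|x l IHl]; [left | right].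
  have [m nm [p' sp' tp']] := IH n p sp.
  have [h hh] := stage_hom nm.
  exists m => //; exists (h q); first exact: ev_hom sq.
  apply: ev_context (ev_hom hh sq) => p'' /(holds_functional (@stage_det m) sp').
  by move=> <-.
Qed.

Lemma eventually_all (P : nat -> nat -> Prop) b :
  (forall f m n, m <= n -> P f m -> P f n) -> (forall f, exists n, P f n) ->
  exists n, forall f, f < b -> P f n.
Proof.
move=> mono ex; elim: b => [|b [n nP]]; first by exists 0.
have [m mP] := ex b; exists (maxn m n) => f.
rewrite ltnS leq_eqVlt => /orP[/eqP->|/nP fP].
  by apply: mono mP; apply: leq_maxl.
by apply: mono fP; apply: leq_maxr.
Qed.

(** There are finitely many symbols, so some stage [N] has merged [f(K,...,K)] with [K] for every
    symbol [f] that ever occurs. Sending every state of the next stage to the class of [K] is then a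
    homomorphism into stage [N], which is thus a fixpoint. *)
Lemma collapse_terminates k :
  (forall u, term_wf (trs_sig R) u -> rewrites R u (App k [::])) ->
  eqsat_terminates G.
Proof.
move=> toK; set K : term void := App k [::].
(* With no states there is no firing, as a firing has a root state; [G] is then its own fixpoint. *)
case: (classic (exists q : state G, True)) => [[q0 _]|no]; last first.
  exists 0, G; split; first exact: is_ICO_iter0.
  exists G; last by exists id, id; split=> //; apply: id_hom.
  have noq (q : state G) : False by apply: no; exists q.
  have nox (x : prestate G) : False by case: x => [q|/(@fr_root _ _) q]; apply: (noq q).
  split=> //.
  - exists (fun p : state (TR G) => match nox (rep p) with end) => f qs q.
    by case: (nox (rep q)).
  - by move=> C _ [h _]; exists (fun q => h (emb q)) => f qs q; case: (noq q).
pose occurs f := exists n ts (q : state (stage n)), ev (App f ts) q.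
pose a f := nth 0 (trs_sig R) f.
(* The premise makes [P f] vacuous for symbols that never occur, so that a stage exists for each
   symbol. *)
pose P f n := occurs f ->
  exists2 q : state (stage n), ev (App f (nseq (a f) K)) q & ev K q.
have Pmono f m n : m <= n -> P f m -> P f n.
  move=> mn Pm /Pm[q h1 h2]; have [h hh] := stage_hom mn.
  by exists (h q); apply: ev_hom.
have Pex f : exists n, P f n.
  case: (classic (occurs f)) => [[n [ts [q tq]]]|nf]; last by exists 0.
  have sz : size ts = a f.
    by have /= /andP[/andP[_ /eqP e] _] := holds_wf tq; rewrite /a e.
  have wf_ts t : List.In t ts -> term_wf (trs_sig R) t.
    by have /= /andP[_ h] := holds_wf tq => in_ts; apply: term_wf_arg in_ts h.
  have rw : rewrites R (App f ts) (App f (nseq (a f) K)).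
    apply: rewrites_args; rewrite -sz.
    elim: ts wf_ts {tq sz} => //= t ts IH wf_ts.
    split; first by apply: toK; apply: wf_ts; left.
    by apply: IH => u ?; apply: wf_ts; right.
  (* First [f(ts)] merges with [f(K,...,K)], then the latter with [K]. *)
  have [m _ [p _ p2]] := stage_rewrites rw tq.
  have [m' _ [p' p1' p2']] := stage_rewrites (toK _ (holds_wf p2)) p2.
  by exists m' => _; exists p'.
have [N NP] := eventually_all (size (trs_sig R)) Pmono Pex.
have occ f n ts (q : state (stage n)) : ev (App f ts) q -> f < size (trs_sig R) /\ P f N.
  move=> tq; have /= /andP[/andP[fs _] _] := holds_wf tq.
  by split=> //; apply: NP.
have rN n : reachable (stage n) by case: (stage_egraph n).
(* Some term has a value and rewrites to [K], so the symbol [k] occurs and [P k N] gives [K] a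
   value. *)
have [kN kNP] : exists q : state (stage N), ev K q.
  have [t tq] := (ev_reachable G).1 (rN 0) q0.
  have [m _ [p _ Kp]] := @stage_rewrites _ _ (toK _ (holds_wf tq)) 0 _ tq.
  have [_ []] := occ _ _ _ _ Kp; last by move=> q _; exists q.
  by exists m, [::], p.
(* Every symbol that ever occurs maps the class of [K] to itself at stage [N]. *)
have allK u n (q : state (stage n)) : ev u q -> ev u kN.
  elim/term_ind_In: u n q => [[]|f ts IH] n q tq.
  have [_ []] := occ _ _ _ _ tq; first by exists n, ts, q.
  move=> p fp /(holds_functional (@stage_det N) kNP) e; subst p.
  case: fp => qs ks_qs d; exists qs => //.
  have /= /andP[/andP[_ /eqP sz] _] := holds_wf tq.
  case: tq => ps ts_ps _; move: ks_qs; rewrite /a sz.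
  elim: ts qs ps IH ts_ps {d sz} => [|t ts IHts] [|p qs] [|p' ps] //= IH.
  case=> tp' ts_ps [Kp Ks_qs]; split; last first.
    by apply: IHts ts_ps Ks_qs => u ?; apply: IH; right.
  rewrite -(holds_functional (@stage_det N) kNP Kp).
  by apply: IH tp'; left.
(* Ground terms that reach the states of the transition at stage [n] all evaluate to [kN] at stage
   [N]. *)
have allkN n (q : state (stage n)) f qs : delta f qs q ->
    delta (a := stage N) f (nseq (size qs) kN) kN.
  move=> d; have [ts ts_qs] := @all2P_exists _ _ (fun q t => ev t q) qs
    (fun q _ => (ev_reachable _).1 (rN n) q).
  have tq : ev (App f ts) q.
    by exists qs => //; elim: qs ts ts_qs {d} => [|p qs IH] [|t ts] //= [? /IH].
  have [ps ts_ps] := allK _ _ _ tq; suff -> : ps = nseq (size qs) kN by [].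
  have -> : size qs = size ts by apply: all2P_size ts_qs.
  apply: all2P_functional ts_ps _.
    by move=> ? ? ? _; apply/holds_functional/stage_det.
  elim: ts qs ts_qs {d tq} => [|t ts IH] [|p qs] //= [tp /IH]; split=> //.
  exact: allK tp.
exists N, (stage N); split; first exact: stage_iter.
exists (stage N); last by exists id, id; split=> //; apply: id_hom.
split; first exact: stage_egraph.
- apply: (@hom_le_trans _ _ (stage N.+1)); first by case: (stage_is_ICO N).
  exists (fun _ => kN) => f qs q d; rewrite (_ : map _ _ = nseq (size qs) kN).
    exact: (allkN N.+1 q).
  by elim: qs {d} => //= _ qs ->.
- move=> C _; apply: hom_le_trans.
  by exists (@emb R (stage N)); apply: emb_hom.
Qed.

End Stages.

(** * An interpreter of WHILE programs *)

(** Variables are unary numerals; past its end the list reads as [Nil], because [hd] and [tl] of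
    [Nil] are [Nil]. *)
Fixpoint lookup_tree (x m : tree) : tree :=
  if x is Cons _ x' then lookup_tree x' (tl m) else hd m.

Fixpoint update_tree (x m v : tree) : tree :=
  if x is Cons _ x' then Cons (hd m) (update_tree x' (tl m) v)
  else Cons v (tl m).

(** Tags are told apart by the length of their right spine, as in [expr_code]. Malformed codes have
    a value too, which lets the function interpret a symbol in the models. *)
Fixpoint eval_tree (e m : tree) : tree :=
  match e with
  | Cons Nil x => lookup_tree x m
  | Cons (Cons _ Nil) (Cons a b) => Cons (eval_tree a m) (eval_tree b m)
  | Cons (Cons _ (Cons _ Nil)) a => hd (eval_tree a m)
  | Cons (Cons _ (Cons _ (Cons _ _))) a => tl (eval_tree a m)
  | _ => Nil
  end.

Definition select (b x y : tree) : tree := if b is Nil then x else y.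

(* [decode (encode d s) t] pushes [d] on the stack [t] and goes on with [s]. *)
Fixpoint encode (d s : tree) : tree :=
  if d is Cons a b then encode b (encode a (Cons ttrue s)) else Cons Nil s.

Fixpoint decode (s t : tree) : tree :=
  match s with
  | Nil => hd t
  | Cons Nil s' => decode s' (Cons Nil t)
  | Cons (Cons _ _) s' =>
      decode s' (Cons (Cons (hd t) (hd (tl t))) (tl (tl t)))
  end.

Lemma decode_encode d : decode (encode d Nil) Nil = d.
Proof.
suff H s t : decode (encode d s) t = decode s (Cons d t) by rewrite H.
by elim: d s t => //= a IHa b IHb s t; rewrite IHb IHa.
Qed.

(* A control stack of commands, and a store as a list. *)
Definition config := (tree * tree)%type.

(** [None] means an empty control stack or a malformed command. *)
Definition next (c : config) : option config :=
  match c with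
  | (Cons (Cons Nil (Cons x e)) k, m) =>
      Some (k, update_tree x m (eval_tree e m))
  | (Cons (Cons (Cons _ Nil) (Cons a b)) k, m) => Some (Cons a (Cons b k), m)
  | (Cons (Cons (Cons t (Cons t' t'')) (Cons e a)) k, m) =>
      Some (select (eval_tree e m) k
        (Cons a (Cons (Cons (Cons t (Cons t' t'')) (Cons e a)) k)), m)
  | _ => None
  end.

Definition run_for (n : nat) (c : config) : option config :=
  iter n (obind next) (Some c).

(** * The signature and the rewriting system *)

Section Symbols.
Variable V : Type.
Definition tnil : term V := App 0 [::].
Definition tcons a b : term V := App 1 [:: a; b].
Definition thd a : term V := App 2 [:: a].
Definition ttl a : term V := App 3 [:: a].
Definition tlookup x m : term V := App 4 [:: x; m].
Definition tupdate x m v : term V := App 5 [:: x; m; v].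
Definition teval e m : term V := App 6 [:: e; m].
Definition tselect b x y : term V := App 7 [:: b; x; y].
Definition tdecode s t : term V := App 8 [:: s; t].
Definition tinit : term V := App 9 [::].
Definition tstart s : term V := App 10 [:: s].
Definition trun t k m : term V := App 11 [:: t; k; m].
Definition tjoin x y : term V := App 12 [:: x; y].
Definition tbot : term V := App 13 [::].
Fixpoint quote (d : tree) : term V :=
  if d is Cons a b then tcons (quote a) (quote b) else tnil.
End Symbols.

Arguments tnil {V}.
Arguments tinit {V}.
Arguments tbot {V}.
Arguments quote {V}.

Definition interp_sig : signature := [:: 0; 2; 1; 1; 2; 3; 2; 3; 2; 0; 1; 3; 2; 0].

(* [tinit] joins every class as a unit of [tjoin]; once it equals a halted
   configuration, every class is equal to [tbot]. *)
Definition interp_rules : seq rule :=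
  let x := Var 0 in let y := Var 1 in let z := Var 2 in let t := Var 3 in
  let m := Var 4 in let u := Var 5 in let v := Var 6 in let w := Var 7 in
  [:: (x, tjoin x tinit);
      (tjoin x (trun t tnil m), tbot);
      (tstart x, trun tnil (tcons (tdecode x tnil) tnil)
                   (tcons (tdecode x tnil) tnil));
      (trun t (tcons (tcons tnil (tcons x y)) z) m,
         trun (tcons tnil t) z (tupdate x m (teval y m)));
      (trun t (tcons (tcons (tcons u tnil) (tcons x y)) z) m,
         trun (tcons tnil t) (tcons x (tcons y z)) m);
      (trun t (tcons (tcons (tcons u (tcons v w)) (tcons x y)) z) m,
         trun (tcons tnil t)
           (tselect (teval x m) z
              (tcons y (tcons (tcons (tcons u (tcons v w)) (tcons x y)) z))) m);
      (thd tnil, tnil);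
      (thd (tcons x y), x);
      (ttl tnil, tnil);
      (ttl (tcons x y), y);
      (tlookup tnil m, thd m);
      (tlookup (tcons y x) m, tlookup x (ttl m));
      (tupdate tnil m z, tcons z (ttl m));
      (tupdate (tcons y x) m z, tcons (thd m) (tupdate x (ttl m) z));
      (teval tnil m, tnil);
      (teval (tcons tnil x) m, tlookup x m);
      (teval (tcons (tcons u tnil) tnil) m, tnil);
      (teval (tcons (tcons u tnil) (tcons x y)) m,
         tcons (teval x m) (teval y m));
      (teval (tcons (tcons u (tcons v tnil)) x) m, thd (teval x m));
      (teval (tcons (tcons u (tcons v (tcons w z))) x) m, ttl (teval x m));
      (tselect tnil x y, x);
      (tselect (tcons z t) x y, y);
      (tdecode tnil x, thd x);
      (tdecode (tcons tnil y) x, tdecode y (tcons tnil x));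
      (tdecode (tcons (tcons z t) y) x,
         tdecode y (tcons (tcons (thd x) (thd (ttl x))) (ttl (ttl x))))].

(** The input is serialised by [encode] to a flat list of flags, because a program can write the
    term for such a list by prepending alone; the rules for [tdecode] restore the tree. *)
Definition input_rule (s : tree) : rule := (tinit, tstart (quote s)).

Lemma input_rule_wf s : rule_wf interp_sig (input_rule s).
Proof.
have wfq : term_wf interp_sig (quote s : term nat).
  by elim: s => //= a -> b ->.
have varsq : vars (quote s : term nat) = [::] by elim: s {wfq} => //= a -> b ->.
by rewrite /rule_wf /= wfq /= varsq.
Qed.

Lemma interp_wf s :
  all (rule_wf interp_sig) (input_rule s :: interp_rules).
Proof. by rewrite [all _ _]/= -/interp_rules input_rule_wf. Qed.

Definition interp (s : tree) : trs := Trs (interp_wf s).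

(** * Simulation of the interpreter by rewriting *)

Section Rewriting.
Variable inp : tree.
Notation "s ~> t" := (rewrites (interp inp) s t) (at level 70).

Definition env (ts : seq (term void)) : nat -> term void := nth tnil ts.

Lemma rw_nth i ts : i < size interp_rules ->
  let r := nth (tnil, tnil) interp_rules i in
  subst (env ts) r.1 ~> subst (env ts) r.2.
Proof.
move=> ltir; apply: rw_rule; right; elim: interp_rules i ltir => // r rs IH [|i].
  by left.
by move=> /IH; right.
Qed.

(* Searches for the rule whose instance is the goal; [ts] lists the values of variables 0, 1 and so
   on, with [tnil] as padding. *)
Tactic Notation "rule" uconstr(ts) :=
  let rec go n :=
    match n with
    | 25 => fail 1
    | _ => first [exact (@rw_nth n ts isT) | go constr:(S n)]
    end in
  go constr:(0).

Ltac arg := apply: rewrites_args; repeat split; try exact: rw_refl.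

Lemma rw_hd a : thd (quote a) ~> quote (hd a).
Proof. case: a => [|a b]; [rule [::] | rule [:: quote a; quote b]]. Qed.

Lemma rw_tl a : ttl (quote a) ~> quote (tl a).
Proof. case: a => [|a b]; [rule [::] | rule [:: quote a; quote b]]. Qed.

Lemma rw_lookup x m : tlookup (quote x) (quote m) ~> quote (lookup_tree x m).
Proof.
elim: x m => [|y _ x IH] m /=.
  apply: rw_trans (rw_hd m); rule [:: tnil; tnil; tnil; tnil; quote m].
apply: rw_trans (IH (tl m)).
apply: (@rw_trans _ _ (tlookup (quote x) (ttl (quote m)))).
  rule [:: quote x; quote y; tnil; tnil; quote m].
by arg; apply: rw_tl.
Qed.

Lemma rw_update x m v :
  tupdate (quote x) (quote m) (quote v) ~> quote (update_tree x m v).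
Proof.
elim: x m => [|y _ x IH] m /=.
  apply: (@rw_trans _ _ (tcons (quote v) (ttl (quote m)))).
    rule [:: tnil; tnil; quote v; tnil; quote m].
  by arg; apply: rw_tl.
apply: (@rw_trans _ _ (tcons (thd (quote m))
    (tupdate (quote x) (ttl (quote m)) (quote v)))).
  rule [:: quote x; quote y; quote v; tnil; quote m].
arg; first exact: rw_hd.
by apply: rw_trans (IH (tl m)); arg; apply: rw_tl.
Qed.

Lemma rw_eval e m : teval (quote e) (quote m) ~> quote (eval_tree e m).
Proof.
move: e; fix IH 1; case=> [|[|u [|v [|w z]]] x].
- rule [:: tnil; tnil; tnil; tnil; quote m].
- apply: rw_trans (rw_lookup x m).
  rule [:: quote x; tnil; tnil; tnil; quote m].
- case: x => [|a b] /=.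
    rule [:: tnil; tnil; tnil; tnil; quote m; quote u].
  apply: (@rw_trans _ _ (tcons (teval (quote a) (quote m)) (teval (quote b) (quote m)))).
    rule [:: quote a; quote b; tnil; tnil; quote m; quote u].
  by apply: rewrites_args; split; [|split].
- apply: rw_trans (rw_hd (eval_tree x m)).
  apply: (@rw_trans _ _ (thd (teval (quote x) (quote m)))).
    rule [:: quote x; tnil; tnil; tnil; quote m; quote u; quote v].
  by apply: rewrites_args; split.
- apply: rw_trans (rw_tl (eval_tree x m)).
  apply: (@rw_trans _ _ (ttl (teval (quote x) (quote m)))).
    rule [:: quote x; tnil; quote z; tnil; quote m; quote u; quote v; quote w].
  by apply: rewrites_args; split.
Qed.

Lemma rw_select b x y :
  tselect (quote b) (quote x) (quote y) ~> quote (select b x y).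
Proof.
case: b => [|b c] /=; first by rule [:: quote x; quote y].
rule [:: quote x; quote y; quote b; quote c].
Qed.

Lemma rw_decode s t : tdecode (quote s) (quote t) ~> quote (decode s t).
Proof.
elim: s t => [|[|a b] _ s IH] t /=.
- apply: rw_trans (rw_hd t); rule [:: quote t].
- apply: rw_trans (IH (Cons Nil t)); rule [:: quote t; quote s].
- apply: rw_trans (IH _).
  apply: (@rw_trans _ _ (tdecode (quote s) (tcons (tcons (thd (quote t))
      (thd (ttl (quote t)))) (ttl (ttl (quote t)))))).
    rule [:: quote t; quote s; quote a; quote b].
  have rw_tlt := rw_tl t.
  arg; arg; last by apply: rw_trans (rw_tl (tl t)); arg.
  arg; first exact: rw_hd.
  by apply: rw_trans (rw_hd (tl t)); arg.
Qed.

(** The counter keeps the configurations of a run distinct even when control and store repeat. *)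
Definition run_term n (c : config) : term void :=
  trun (quote (enc_nat n)) (quote c.1) (quote c.2).

Lemma rw_next n c c' : next c = Some c' -> run_term n c ~> run_term n.+1 c'.
Proof.
case: c => -[|[|g [|x y]] z] m //=.
  by case: g => [|? []].
case: g => [|u [|v w]] /= [<-]; rewrite /run_term /=.
- apply: (@rw_trans _ _ (trun (tcons tnil (quote (enc_nat n))) (quote z)
      (tupdate (quote x) (quote m) (teval (quote y) (quote m))))).
    rule [:: quote x; quote y; quote z; quote (enc_nat n); quote m].
  arg; apply: rw_trans (rw_update _ _ _); arg; exact: rw_eval.
- rule [:: quote x; quote y; quote z; quote (enc_nat n); quote m; quote u].
- apply: (@rw_trans _ _ (trun (tcons tnil (quote (enc_nat n)))
      (tselect (teval (quote x) (quote m)) (quote z)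
         (quote (Cons y (Cons (Cons (Cons u (Cons v w)) (Cons x y)) z))))
      (quote m))).
    rule [:: quote x; quote y; quote z; quote (enc_nat n); quote m; quote u;
             quote v; quote w].
  arg; apply: rw_trans (rw_select _ _ _); arg; exact: rw_eval.
Qed.

Definition init_config : config :=
  let d := decode inp Nil in (Cons d Nil, Cons d Nil).

Lemma rw_run n c : run_for n init_config = Some c -> tinit ~> run_term n c.
Proof.
elim: n c => [|n IH] c /=.
  case=> <-; apply: (@rw_trans _ _ (tstart (quote inp))).
    suff <- : subst (env [::]) (quote inp) = quote inp.
      by apply: (@rw_rule (interp inp) (input_rule inp)); left.
    by elim: inp => //= a -> b ->.
  apply: (@rw_trans _ _ (trun tnil (tcons (tdecode (quote inp) tnil) tnil)
                   (tcons (tdecode (quote inp) tnil) tnil))).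
    rule [:: quote inp].
  by have rw := rw_decode inp Nil; arg; arg; exact: rw.
case e: (run_for n init_config) => [c'|] //= /rw_next rw.
exact: rw_trans (IH _ e) (rw n).
Qed.

Lemma rw_halt n m u :
  run_for n init_config = Some (Nil, m) -> u ~> tbot.
Proof.
move=> /rw_run rw; apply: (@rw_trans _ _ (tjoin u tinit)); first by rule [:: u].
apply: (@rw_trans _ _ (tjoin u (run_term n (Nil, m)))); first by arg.
rule [:: u; tnil; tnil; quote (enc_nat n); quote m].
Qed.

End Rewriting.

(** * Models of diverging runs, and non-termination *)

Section Model.
Variable inp : tree.

(* The class [None] is that of [tinit]; only the first [n] configurations of
   the computation are present. *)
Definition model_delta n (f : nat) (qs : seq (option tree)) (q : option tree) :
    Prop :=
  match f, qs with
  | 0, [::] => q = Some Nil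
  | 1, [:: Some a; Some b] => q = Some (Cons a b)
  | 2, [:: Some a] => q = Some (hd a)
  | 3, [:: Some a] => q = Some (tl a)
  | 4, [:: Some x; Some m] => q = Some (lookup_tree x m)
  | 5, [:: Some x; Some m; Some v] => q = Some (update_tree x m v)
  | 6, [:: Some e; Some m] => q = Some (eval_tree e m)
  | 7, [:: Some b; Some x; Some y] => q = Some (select b x y)
  | 8, [:: Some s; Some t] => q = Some (decode s t)
  | 9, [::] => q = None
  | 10, [:: Some s] => q = None /\ s = inp
  | 11, [:: Some t; Some k; Some m] => q = None /\ exists i,
      [/\ i <= n, t = enc_nat i & run_for i (init_config inp) = Some (k, m)]
  | 12, [:: q'; None] => q = q'
  | _, _ => False
  end.

Lemma model_wf n f qs q :
  model_delta n f qs q -> has_arity (trs_sig (interp inp)) f (size qs).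
Proof.
by do 14 (case: f => [|f]; first by case: qs => [|[?|] [|[?|] [|[?|] [|? ?]]]]).
Qed.

Definition model n : automaton (trs_sig (interp inp)) :=
  Automaton (@model_wf n).

Lemma model_det n : trans_det (model n).
Proof.
move=> f qs q q' /=.
do 14 (case: f => [|f];
  first by case: qs => [|[?|] [|[?|] [|[?|] [|? ?]]]] //=;
    solve [by move=> -> -> | by case=> -> _ [-> _]]).
by [].
Qed.

Definition start_automaton_delta (f : nat) (qs : seq unit) (q : unit) : Prop :=
  f = 9 /\ qs = [::].

Lemma start_automaton_wf f qs q :
  start_automaton_delta f qs q -> has_arity (trs_sig (interp inp)) f (size qs).
Proof. by case=> -> ->. Qed.

Definition start_automaton : automaton (trs_sig (interp inp)) :=
  Automaton start_automaton_wf.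

Lemma start_automaton_egraph : egraph start_automaton.
Proof.
apply/egraphP; split; first by move=> f qs [] [].
by apply/ev_reachable => -[]; exists tinit; exists [::].
Qed.

Lemma holds_quote V n (rho : V -> option tree) d :
  holds (A := model n) rho (quote d) (Some d).
Proof.
elim: d => [|a IHa b IHb] /=; first by exists [::].
by exists [:: Some a; Some b].
Qed.

Lemma model_reachable n : reachable (model n).
Proof.
apply/ev_reachable => -[d|].
  by exists (quote d); apply: holds_quote.
by exists tinit, [::].
Qed.

Lemma model_egraph n : egraph (model n).
Proof. by apply/egraphP; split; [apply: model_det | apply: model_reachable]. Qed.

Hypothesis diverges : forall i, run_for i (init_config inp) <> None.

Lemma never_halts i m : run_for i (init_config inp) <> Some (Nil, m).
Proof.
by move=> e; apply: (diverges (i := i.+1)); rewrite /run_for /= -/(run_for i _) e.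
Qed.

Lemma model_hom n : @hom _ (model n) (model n.+1) id.
Proof.
move=> f qs q; rewrite map_id /=.
do 14 (case: f => [|f];
  first by case: qs => [|[?|] [|[?|] [|[?|] [|? ?]]]] //=;
    case=> -> [i [/leqW lein -> ri]]; split=> //; exists i).
by [].
Qed.

(** Takes apart a run on a left-hand side, splitting model states until the shapes it forces are
    visible. *)
Ltac invert := repeat match goal with
  | H : exists2 _, _ & _ |- _ => destruct H
  | H : _ /\ _ |- _ => destruct H
  | H : exists _, _ |- _ => destruct H
  | H : [/\ _, _ & _] |- _ => destruct H
  | H : False |- _ => destruct H
  | H : Some _ = Some _ |- _ => injection H; clear H; intros; subst
  | H : Some _ = None |- _ => discriminate H
  | H : None = Some _ |- _ => discriminate H
  | H : _ = ?x |- _ => is_var x; subst x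
  | H : ?x = _ |- _ => is_var x; subst x
  | H : context [match ?x with _ => _ end] |- _ => is_var x; destruct x; simpl in H
  | s : nat -> option tree, H : context [match ?s ?i with _ => _ end] |- _ =>
      destruct (s i) eqn:? in *; simpl in H
  end.

Lemma holds_App V n (rho : V -> option tree) f ts qs q :
  all2P (holds (A := model n) rho) ts qs -> model_delta n f qs q ->
  holds (A := model n) rho (App f ts) q.
Proof. by exists qs. Qed.

(** Builds a run on a right-hand side; the argument states are metavariables, filled in by
    evaluating the arguments. *)
Ltac derive := lazymatch goal with
  | |- holds _ (Var _) _ => first [eassumption | reflexivity]
  | |- @holds _ (model ?n) ?V ?rho ?t ?q =>
      let t' := eval hnf in t in
      lazymatch t' with App ?f ?ts =>
        eapply (@holds_App V n rho f ts _ q);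
        [repeat (eapply all2P_cons; [derive|]); apply all2P_nil | ];
        simpl; repeat match goal with
          s : nat -> option tree, E : ?s ?i = Some _ |- context [?s ?i] => rewrite E
        end; simpl; try reflexivity
      end
  end.

(** The counter is 0 for the rule that starts the run and a successor for the rules that make a
    step. *)
Ltac step_model :=
  split=> //; first
  [ exists 0; by split
  | match goal with
    | H : is_true (?i <= _), E : run_for ?i _ = Some _ |- _ =>
        exists i.+1; split=> //; rewrite /run_for /= -/(run_for i _) E; reflexivity
    end ].

(** Rules that make a step increase the counter, which the bound [n.+1] admits. The rule for halted
    configurations has no instance because the run diverges, and the others hold by definition of
    the model. *)
Lemma model_rule n r (s : nat -> option tree) (c : option tree) :
  List.In r (trs_rules (interp inp)) ->
  holds (A := model n) s r.1 c -> holds (A := model n.+1) s r.2 c.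
Proof.
case=> [<-|].
  case=> -[|? ?] //= _ ->; exists [:: Some inp] => //=.
  by split=> //; apply: holds_quote.
rewrite /interp_rules.
do 25 (case=> [<-|]; [
  cbn [fst snd] => H; simpl in H; invert;
  try solve [derive | derive; step_model | exfalso; eapply never_halts; eassumption] | ]).
by [].
Qed.

(** [TR_lift] extends a homomorphism into [model n] to one from the flattening into [model n.+1],
    and leastness of the closure passes it on to the next iterate. *)
Lemma iterate_hom n H :
  is_ICO_iter start_automaton n H -> egraph H /\ hom_le H (model n).
Proof.
elim=> {n H} [|n H K _ [eH [h hh]] [eK _ least]].
  split; first exact: start_automaton_egraph.
  by exists (fun _ => None) => f _ _ [-> ->].
split=> //; apply: least; first exact: model_egraph.
apply: (@TR_lift _ _ (model n.+1) h); first exact: model_det.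
  by move=> f qs q /hh /model_hom; rewrite map_id.
move=> r s c /firesP[inr hc]; apply: (@model_rule n) => //.
exact: (holds_hom hh hc).
Qed.

Lemma start_iterate n H :
  is_ICO_iter start_automaton n H -> exists q : state H, ev tinit q.
Proof.
elim=> {n H} [|n H K _ [q iq] [_ [h hh] _]]; first by exists tt, [::].
by exists (h (emb q)); apply: (ev_hom hh); apply: (ev_hom (@emb_hom _ H)).
Qed.

Lemma enc_nat_inj : injective enc_nat.
Proof. by elim=> [|i IH] [|j] //= [/IH->]. Qed.

Lemma holds_run V n (rho : V -> option tree) t k m q :
  holds (A := model n) rho (trun t k m) q ->
  exists a b c, [/\ holds (A := model n) rho t a, holds (A := model n) rho k b,
    holds (A := model n) rho m c & model_delta n 11 [:: a; b; c] q].
Proof.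
case=> -[|a [|b [|c [|? ?]]]]; try by case=> // _ [] // _ [] // _ [].
by case=> ta [kb [mc _]] d; exists a, b, c.
Qed.

(** At a fixpoint reached after [n] iterations, the configuration of step [n.+1] has the same value
    as [tinit]. But the fixpoint maps to [model n], where no counter exceeds [n]. *)
Lemma start_nonterminating : ~ eqsat_terminates start_automaton.
Proof.
case=> n [H [itH [H' [_ [g gg] _] [h [_ [hh _ _ _]]]]]].
have [eH [phi hphi]] := iterate_hom itH.
have [q iq] := start_iterate itH.
have hg : hom (h \o g) by move=> f qs p d; rewrite map_comp; apply/hh/gg.
case e: (run_for n.+1 (init_config inp)) => [c|]; last by case: (diverges e).
have := fixpoint_rewrites eH hg (rw_run e) iq.
move=> /(ev_hom hphi)/holds_run[t [k [m [ht hk hm]]]].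
have et := holds_functional (@model_det n) ht (holds_quote n _ (enc_nat n.+1)).
have ek := holds_functional (@model_det n) hk (holds_quote n _ c.1).
have em := holds_functional (@model_det n) hm (holds_quote n _ c.2).
rewrite et ek em => -[_ [i [lein /enc_nat_inj e' _]]].
by move: lein; rewrite -e' ltnn.
Qed.

End Model.

(** * The diagonal argument *)

Fixpoint expr_code (e : expr) : tree :=
  match e with
  | EVar x => Cons Nil (enc_nat x)
  | ENil => Nil
  | ECons a b => Cons (enc_nat 1) (Cons (expr_code a) (expr_code b))
  | EHd a => Cons (enc_nat 2) (expr_code a)
  | ETl a => Cons (enc_nat 3) (expr_code a)
  end.

Fixpoint com_code (c : com) : tree :=
  match c with
  | Assign x e => Cons Nil (Cons (enc_nat x) (expr_code e))
  | Seq a b => Cons (enc_nat 1) (Cons (com_code a) (com_code b))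
  | While e a => Cons (enc_nat 2) (Cons (expr_code e) (com_code a))
  end.

(** * Correctness of the interpreter on coded programs *)

Definition represents (M : tree) (m : store) : Prop :=
  forall x, lookup_tree (enc_nat x) M = m x.

Lemma lookup_update x y M v :
  lookup_tree (enc_nat y) (update_tree (enc_nat x) M v) =
  if y == x then v else lookup_tree (enc_nat y) M.
Proof. by elim: x y M => [|x IH] [|y] M //=; rewrite IH. Qed.

Lemma eval_code e M m : represents M m -> eval_tree (expr_code e) M = eval m e.
Proof. by move=> r; elim: e => //= [a -> b ->|a ->|a ->]. Qed.

Definition reaches (c c' : config) : Prop := exists n, run_for n c = Some c'.

Lemma run_forD i j c c' :
  run_for i c = Some c' -> run_for (j + i) c = run_for j c'.
Proof. by rewrite /run_for iterD => ->. Qed.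

Lemma reaches_trans c c' c'' : reaches c c' -> reaches c' c'' -> reaches c c''.
Proof. by case=> i ri [j rj]; exists (j + i); rewrite (run_forD _ ri). Qed.

Lemma reaches_next c c' : next c = Some c' -> reaches c c'.
Proof. by exists 1. Qed.

(** The rest [k] of the control stack is arbitrary, since in sequences and loops a command runs on
    top of others. *)
Lemma exec_reaches c m m' : exec c m m' ->
  forall M k, represents M m ->
  exists2 M', represents M' m' & reaches (Cons (com_code c) k, M) (k, M').
Proof.
elim=> {c m m'} [x e m|c1 c2 m m' m'' _ IH1 _ IH2|e c m e0
  |e c m m' m'' e0 _ IH1 _ IH2] M k r.
- exists (update_tree (enc_nat x) M (eval m e)).
    by move=> y; rewrite lookup_update r.
  by apply: reaches_next; rewrite /= (eval_code _ r).
- have [M1 r1 s1] := IH1 M (Cons (com_code c2) k) r.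
  have [M2 r2 s2] := IH2 M1 k r1.
  exists M2 => //; apply: reaches_trans s2; apply: reaches_trans s1.
  exact: reaches_next.
- exists M => //; apply: reaches_next.
  by rewrite /= (eval_code _ r) e0.
- have [M1 r1 s1] := IH1 M (Cons (com_code (While e c)) k) r.
  have [M2 r2 s2] := IH2 M1 k r1.
  exists M2 => //; apply: reaches_trans s2; apply: reaches_trans s1.
  apply: reaches_next; rewrite /= (eval_code _ r).
  by case: (eval m e) e0.
Qed.

Definition loop : com := While (EVar 0) (Assign 0 (EVar 0)).

(** A round takes two steps, the test and the assignment, and keeps the first entry of the store;
    the induction goes down by two. *)
Lemma loop_diverges k M n :
  hd M <> Nil -> run_for n (Cons (com_code loop) k, M) <> None.
Proof.
have sel M' x y : hd M' <> Nil -> select (hd M') x y = y by case: (hd M').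
have step2 M' : hd M' <> Nil -> exists2 M'', hd M'' <> Nil &
    run_for 2 (Cons (com_code loop) k, M') = Some (Cons (com_code loop) k, M'').
  by move=> hM'; exists (Cons (hd M') (tl M')) => //; rewrite /run_for /= sel.
elim/ltn_ind: n M => -[|[|n]] IH M hM //.
have [M'' hM'' r2] := step2 M hM.
by rewrite -(addn2 n) (run_forD n r2); apply: IH.
Qed.

(** * The reduction as a WHILE program *)

Fixpoint const (d : tree) : expr :=
  if d is Cons a b then ECons (const a) (const b) else ENil.

Lemma eval_const m d : eval m (const d) = d.
Proof. by elim: d => //= a -> b ->. Qed.

Definition enc_quote (d : tree) : tree := enc_term (quote d).

(** Prepends the flag [b] to the quoted list in variable 1, by building the code of an application
    of symbol 1, [tcons]. *)
Definition emit (b : tree) : com :=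
  Assign 1 (ECons (const ttrue) (ECons (const (enc_nat 1))
    (ECons (const (enc_quote b)) (ECons (EVar 1) ENil)))).

(** Right subtrees are stacked for later. As emission prepends, the whole traversal writes the flags
    in reverse preorder, the order of [encode]. *)
Definition descend : com :=
  While (EVar 2) (Seq (emit ttrue)
    (Seq (Assign 0 (ECons (ETl (EVar 2)) (EVar 0))) (Assign 2 (EHd (EVar 2))))).

Definition traverse : com :=
  While (EVar 0) (Seq (Assign 2 (EHd (EVar 0))) (Seq (Assign 0 (ETl (EVar 0)))
    (Seq descend (emit Nil)))).

(* Variable 0 holds a stack of trees still to be traversed, variable 1 the
   output and variable 2 the tree whose left spine is being followed. *)
Definition reduction : com :=
  Seq (Assign 1 (const (enc_quote Nil)))
  (Seq (Assign 0 (ECons (EVar 0) ENil))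
  (Seq traverse
  (Seq (Assign 0 (ECons (const (enc_seq enc_nat interp_sig))
    (ECons (ECons (const (enc_term tinit))
      (ECons (const ttrue) (ECons (const (enc_nat 10)) (ECons (EVar 1) ENil))))
      (const (enc_seq enc_rule interp_rules)))))
  (Assign 1 ENil)))).

Definition store3 (a b c : tree) : store :=
  fun x => match x with 0 => a | 1 => b | 2 => c | _ => Nil end.

Lemma exec_assign0 e a b c v :
  eval (store3 a b c) e = v -> exec (Assign 0 e) (store3 a b c) (store3 v b c).
Proof.
move=> ev_e; suff <- : update (store3 a b c) 0 v = store3 v b c.
  by rewrite -ev_e; apply: exec_assign.
by apply: functional_extensionality => -[|x].
Qed.

Lemma exec_assign1 e a b c v :
  eval (store3 a b c) e = v -> exec (Assign 1 e) (store3 a b c) (store3 a v c).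
Proof.
move=> ev_e; suff <- : update (store3 a b c) 1 v = store3 a v c.
  by rewrite -ev_e; apply: exec_assign.
by apply: functional_extensionality => -[|[|x]].
Qed.

Lemma exec_assign2 e a b c v :
  eval (store3 a b c) e = v -> exec (Assign 2 e) (store3 a b c) (store3 a b v).
Proof.
move=> ev_e; suff <- : update (store3 a b c) 2 v = store3 a b v.
  by rewrite -ev_e; apply: exec_assign.
by apply: functional_extensionality => -[|[|[|x]]].
Qed.

Lemma exec_emit b s o x :
  exec (emit b) (store3 s (enc_quote o) x) (store3 s (enc_quote (Cons b o)) x).
Proof. by apply: exec_assign1; rewrite /= !eval_const. Qed.

(** Built backwards: if the traversal ends in [m] once [d] has been written, it does so from the
    point where [d] is about to be. For a pair, the execution for the right subtree is put in front
    first, then that for the left one. *)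
Lemma exec_descend d s o m :
  exec traverse (store3 s (enc_quote (encode d o)) Nil) m ->
  exists2 m', exec (Seq descend (emit Nil)) (store3 s (enc_quote o) d) m' &
    exec traverse m' m.
Proof.
elim: d s o => [|a IHa b IHb] s o tr.
  exists (store3 s (enc_quote (Cons Nil o)) Nil) => //.
  by apply: exec_seq (exec_emit _ _ _ _); apply: exec_while_stop.
have [m1 de1 tr1] := IHb s (encode a (Cons ttrue o)) tr.
have [|m2 de2 tr2] := IHa (Cons b s) (Cons ttrue o).
  apply: exec_while_loop tr1 => //.
  apply: exec_seq; first exact: exec_assign2.
  by apply: exec_seq de1; apply: exec_assign0.
exists m2 => //; inversion de2; subst.
apply: exec_seq; last by eassumption.
apply: exec_while_loop; [by [] | | by eassumption].
apply: exec_seq; first exact: exec_emit.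
apply: exec_seq; first exact: exec_assign0.
exact: exec_assign2.
Qed.

(** In the final store all variables but 0 are [Nil], which is the initial store that [computes]
    prescribes for the next program. *)
Lemma exec_reduction d :
  exec reduction (update (fun _ => Nil) 0 d)
    (update (fun _ => Nil) 0 (enc_trs (interp (encode d Nil)))).
Proof.
have st v : update (fun _ => Nil) 0 v = store3 v Nil Nil.
  by apply: functional_extensionality => -[|[|[|x]]].
rewrite !st; apply: exec_seq; first exact/exec_assign1/eval_const.
apply: exec_seq; first exact: exec_assign0.
have [|m de tr] := @exec_descend d Nil Nil (store3 Nil (enc_quote (encode d Nil)) Nil).
  exact: exec_while_stop.
apply: exec_seq.
  apply: exec_while_loop tr => //.
  apply: exec_seq; first exact: exec_assign2.
  by apply: exec_seq de; apply: exec_assign0.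
apply: exec_seq; last exact: exec_assign1.
apply: exec_assign0.
reflexivity.
Qed.

Theorem theorem33 :
  ~ is_decidable enc_trs
      (fun R : trs =>
         forall G : automaton (trs_sig R),
           egraph G -> finite_automaton G -> eqsat_terminates G).
Proof.
case=> c dec.
(* This program loops unless the answer of [c] is [Nil]; as [s] decodes to [d], [interp s] runs it
   on its own code. *)
pose d := com_code (Seq reduction (Seq c loop)).
set s := encode d Nil.
have [yes no] := dec (interp s).
have reach_loop b : computes c (enc_trs (interp s)) b ->
    exists2 M, hd M = b & reaches (init_config s) (Cons (com_code loop) Nil, M).
  case=> m [ex mb].
  have r0 : represents (Cons d Nil) (update (fun _ => Nil) 0 d).
    by case=> [|x] //=; elim: x.
  have [M1 r1 s1] :=
    exec_reaches (exec_reduction d) (Cons (com_code (Seq c loop)) Nil) r0.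
  have [M2 r2 s2] := exec_reaches ex (Cons (com_code loop) Nil) r1.
  exists M2; first by rewrite -mb -(r2 0).
  rewrite /init_config decode_encode.
  apply: (@reaches_trans _ (Cons (com_code reduction)
      (Cons (com_code (Seq c loop)) Nil), Cons d Nil)).
    exact: reaches_next.
  apply: reaches_trans s1 _.
  apply: (@reaches_trans _ (Cons (com_code c) (Cons (com_code loop) Nil), M1)).
    exact: reaches_next.
  exact: s2.
have nP : ~ forall G : automaton (trs_sig (interp s)),
    egraph G -> finite_automaton G -> eqsat_terminates G.
  move=> P; have [M hM [i ri]] := reach_loop _ (yes P).
  (* A halt at step [j] would persist, whereas from step [i] on the run stays in the loop with
     variable 0 not [Nil]. *)
  have div j : run_for j (init_config s) <> None.
    move=> rj; case: (@loop_diverges Nil M j); first by rewrite hM.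
    rewrite -(run_forD j ri) addnC /run_for iterD -/(run_for j _) rj.
    by elim: (i) => //= n ->.
  apply: (start_nonterminating div); apply: P.
    exact: start_automaton_egraph.
  by exists [:: tt] => -[]; left.
have [M hM [i ri]] := reach_loop _ (no nP).
apply: nP => G eG _.
(* The answer [tfalse] is [Nil], so the test of [loop] fails and one more step empties the control
   stack. *)
have ri1 : run_for i.+1 (init_config s) = Some (Nil, M).
  by rewrite -add1n (run_forD 1 ri) /run_for /= hM.
apply: (collapse_terminates eG) => u _.
exact: rw_halt ri1.
Qed.
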